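(* For a real Banach space $X$ the following are equivalent: (a) $X$ is reflexive and has the Kadec-Klee property; (b) for every nonempty closed convex subset $V$ of $X$, the triplet $(X,V,\mathcal{F}(X))$ has $\mathscr{F}_{cwmc}$-SACP (with respect to the norm topology), where $\mathcal{F}(X)$ is the family of nonempty finite subsets of $X$ and $\mathscr{F}_{cwmc}$ is the class of all convex, weakly strictly monotone, coercive functions $f:\ell_\infty^+(F)\to[0,\infty)$, $F\in\mathcal{F}(X)$.
   Context: $X$ has the Kadec-Klee property if $x,x_n\in S_X$ and $x_n\to x$ weakly imply $x_n\to x$ in norm. For finite $F=\{x_1,\dots,x_N\}$, $\ell_\infty^+(F)$ is identified with $[0,\infty)^N$ with the coordinatewise order. $f$ is monotone if $\varphi_1\le\varphi_2$ implies $f(\varphi_1)\le f(\varphi_2)$; weakly strictly monotone if monotone and $\varphi_1(t)<\varphi_2(t)$ for all $t\in F$ implies $f(\varphi_1)<f(\varphi_2)$; coercive if $f(\varphi)\to\infty$ as $\|\varphi\|_\infty\to\infty$. $r_f(x,F)=f(\|x-x_1\|,\dots,\|x-x_N\|)$, $\mathrm{rad}_V^f(F)=\inf_{v\in V}r_f(v,F)$. $(X,V,\mathfrak{F})$ has $\mathscr{F}$-SACP if for every $F\in\mathfrak{F}$, every $f\in\mathscr{F}$ on $\ell_\infty^+(F)$ and every sequence $(v_n)\subseteq V$ with $r_f(v_n,F)\to\mathrm{rad}_V^f(F)$, $(v_n)$ has a norm-convergent subsequence. *)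

(* Defs.v *)
From HB Require Import structures.
From mathcomp Require Import all_boot all_order all_algebra.
From mathcomp Require Import all_classical all_reals all_analysis.
Set Implicit Arguments. Unset Strict Implicit. Unset Printing Implicit Defensive.
Import Order.TTheory GRing.Theory Num.Theory.
Import numFieldNormedType.Exports.
Local Open Scope classical_set_scope.
Local Open Scope ring_scope.

Section Defs.
Context {R : realType} {X : normedModType R}.

Definition is_clf (f : X -> R) : Prop :=
  (forall (a : R) (x y : X), f (a *: x + y) = a * f x + f y) /\ continuous f.

(** reflexivity: every bounded linear functional Phi on X^* (bounded w.r.t.
    the dual norm ||f||* = inf {M | forall x, |f x| <= M ||x||}) is the
    evaluation at some x : X, i.e. the canonical embedding X -> X^** is onto. *)
Definition reflexive_space : Prop :=
  forall Phi : (X -> R) -> R,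
    (forall (a : R) (f g : X -> R), is_clf f -> is_clf g ->
        Phi (fun x => a * f x + g x) = a * Phi f + Phi g) ->
    (exists C : R, forall (f : X -> R) (M : R), is_clf f ->
        (forall x, `|f x| <= M * `|x|) -> `|Phi f| <= C * M) ->
    exists x0 : X, forall f, is_clf f -> Phi f = f x0.

Definition weakly_to (u : nat -> X) (x : X) : Prop :=
  forall f, is_clf f -> (fun n => f (u n)) @ \oo --> f x.

Definition kadec_klee : Prop :=
  forall (u : nat -> X) (x : X), `|x| = 1 -> (forall n, `|u n| = 1) ->
    weakly_to u x -> u @ \oo --> x.

(** ell_infty^+(F) for F = {x_0,...,x_{N-1}} is identified with [0,oo)^N,
    represented by functions 'I_N -> R with nonnegative values. *)
Definition nonneg_vec (N : nat) (phi : 'I_N -> R) : Prop := forall i, 0 <= phi i.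

Definition F_cwmc (N : nat) (f : ('I_N -> R) -> R) : Prop :=
  [/\ (forall phi, nonneg_vec phi -> 0 <= f phi),
      (forall phi1 phi2 t, nonneg_vec phi1 -> nonneg_vec phi2 -> 0 <= t <= 1 ->
         f (fun i => t * phi1 i + (1 - t) * phi2 i) <= t * f phi1 + (1 - t) * f phi2),
      (forall phi1 phi2, nonneg_vec phi1 -> nonneg_vec phi2 ->
         (forall i, phi1 i <= phi2 i) -> f phi1 <= f phi2),
      (forall phi1 phi2, nonneg_vec phi1 -> nonneg_vec phi2 ->
         (forall i, phi1 i < phi2 i) -> f phi1 < f phi2)
    &
      (forall M : R, exists K : R, forall phi, nonneg_vec phi ->
         K < \big[Num.max/0]_i phi i -> M < f phi)].

Definition r_f (N : nat) (f : ('I_N -> R) -> R) (x : 'I_N -> X) (v : X) : R :=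
  f (fun i => `|v - x i|).

Definition rad (N : nat) (f : ('I_N -> R) -> R) (x : 'I_N -> X) (V : set X) : R :=
  inf [set r_f f x v | v in V].

(** (X, V, F(X)) has F_cwmc-SACP: F ranges over nonempty finite subsets
    {x_0,...,x_{N-1}} of X (N > 0, x injective). *)
Definition SACP_cwmc (V : set X) : Prop :=
  forall (N : nat) (x : 'I_N -> X), (0 < N)%N -> injective x ->
  forall f : ('I_N -> R) -> R, F_cwmc f ->
  forall v : nat -> X, (forall n, V (v n)) ->
    (fun n => r_f f x (v n)) @ \oo --> rad f x V ->
    exists (sigma : nat -> nat) (y : X),
      (forall n, (sigma n < sigma n.+1)%N) /\ (v \o sigma) @ \oo --> y.

End Defs.

(* Main.v *)
Require Import Defs.
From HB Require Import structures.
From mathcomp Require Import all_boot all_order all_algebra.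
From mathcomp Require Import all_classical all_reals all_analysis.
From mathcomp Require Import ring lra.
Set Implicit Arguments. Unset Strict Implicit. Unset Printing Implicit Defensive.
Import Order.TTheory GRing.Theory Num.Theory.
Import numFieldNormedType.Exports.
Local Open Scope classical_set_scope.
Local Open Scope ring_scope.

(** (a) => (b): let [v] be a minimizing sequence and [U] an ultrafilter on [nat]
    containing the cofinite sets.  Coercivity bounds [v], and reflexivity turns
    the functional [g |-> lim_U g (v n)] into a weak [U]-limit [y], which lies
    in [V].  Weak strict monotonicity forces [lim_U |v n - x i| <= |y - x i|]
    for some [i]: otherwise a vector strictly between the two families of
    distances would have value both above and at most the radius.  A countable
    family of functionals separating the closed span of the sequence extracts
    a subsequence converging weakly with convergent norms, and the Kadec-Klee
    property applies.

    (b) => (a): only [F] = {0} and hyperplanes [V] = {g = 1} are used, where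
    (b) says that norm-one sequences on which a norm-one [g] tends to 1 have
    convergent subsequences.  This gives Kadec-Klee directly.  For reflexivity
    the Bishop-Phelps argument in the dual replaces James' theorem: Ekeland's
    principle perturbs [Phi] in the bidual to an element attaining its norm at
    some [f], and Helly's theorem together with the compactness of the slices
    of [f] puts this element at small distance from [X]. *)

(** * The Hahn-Banach theorem for sublinear functionals *)

Section HahnBanach.
Context {R : realType} {V : lmodType R}.
Implicit Types (p q : V -> R).

Definition sublinear p : Prop :=
  (forall x y, p (x + y) <= p x + p y) /\
  (forall t x, 0 <= t -> p (t *: x) = t * p x).

Lemma sublinear0 p : sublinear p -> p 0 = 0.
Proof. by move=> [_ pZ]; rewrite -(scale0r 0) pZ// mul0r. Qed.

Lemma sublinear_ge p x : sublinear p -> - p (- x) <= p x.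
Proof.
move=> sp; have [pD _] := sp; have := pD x (- x).
by rewrite subrr sublinear0// => ?; lra.
Qed.

(** The scaling inequality applied to [t] and to [t^-1] yields positive homogeneity. The index may
    vary with the arguments, which covers both chains of functionals and parametrised infima. *)
Lemma inf_sublinear (I : Type) (D : set I) (F : I -> V -> R) :
    D !=set0 ->
    (forall x, has_lbound [set F i x | i in D]) ->
    (forall i j x y, D i -> D j -> exists2 k, D k & F k (x + y) <= F i x + F j y) ->
    (forall i t x, D i -> 0 < t -> exists2 k, D k & F k (t *: x) <= t * F i x) ->
  sublinear (fun x => inf [set F i x | i in D]).
Proof.
move=> [i0 Di0] Flb FD FZ.
have leF x i : D i -> inf [set F i x | i in D] <= F i x.
  by move=> Di; apply: ge_inf => //; exists i.
have geF x c : (forall i, D i -> c <= F i x) -> c <= inf [set F i x | i in D].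
  move=> h; apply: lb_le_inf; first by exists (F i0 x), i0.
  by move=> _ [i Di <-]; exact: h.
have Zle t x : 0 < t -> inf [set F i (t *: x) | i in D] <= t * inf [set F i x | i in D].
  move=> t0; rewrite mulrC -ler_pdivrMr//; apply: (geF) => i Di.
  have [k Dk Fk] := FZ i t x Di t0.
  by rewrite ler_pdivrMr// (le_trans (leF _ _ Dk))// mulrC.
split=> [x y|t x].
  rewrite -lerBlDl; apply: (geF) => j Dj; rewrite lerBlDl -lerBlDr.
  apply: (geF) => i Di; rewrite lerBlDr.
  by have [k Dk] := FD i j x y Di Dj; exact: le_trans (leF _ _ Dk).
rewrite le_eqVlt => /predU1P[<-|t0].
  rewrite scale0r mul0r.
  (* At the origin the factors 2 and 1/2 bound the infimum from both sides and force it to be 0. *)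
  have := @Zle 2 0 ltac:(lra); have := @Zle 2^-1 0 ltac:(lra).
  by rewrite !scaler0 => ? ?; apply/eqP; rewrite eq_le; apply/andP; split; lra.
apply/eqP; rewrite eq_le Zle//= mulrC -ler_pdivlMr//.
have := @Zle t^-1 (t *: x); rewrite invr_gt0 => /(_ t0).
by rewrite scalerA mulVf ?scale1r ?gt_eqF// mulrC.
Qed.

(** Zorn's lemma for the reversed pointwise order. The infimum of a chain is finite since each
    member satisfies [q x >= - q (- x) >= - p (- x)]. *)
Lemma minimal_sublinear p : sublinear p -> exists q,
  [/\ sublinear q, (forall x, q x <= p x) &
      forall q', sublinear q' -> (forall x, q' x <= q x) -> q' = q].
Proof.
move=> sp; pose T := {q | sublinear q /\ forall x, q x <= p x}.
pose le (q1 q2 : T) := `[< forall x, sval q2 x <= sval q1 x >].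
have [| | | |q qmin] := @Zorn T le.
- by move=> q; apply/asboolP.
- by move=> r s t /asboolP rs /asboolP st; apply/asboolP => x; exact: le_trans (rs x).
- move=> [s ps] [t pt] /asboolP st /asboolP ts; apply: eq_exist.
  by apply/funext => x; apply/eqP; rewrite eq_le (st x) (ts x).
- move=> A totA; have [->|/set0P A0] := eqVneq A set0; first by exists (exist _ p (conj sp (fun=> lexx _))).
  have lb x : has_lbound [set sval q x | q in A].
    exists (- p (- x)) => _ [[q [sq qp]] Aq <-] /=.
    by rewrite (le_trans _ (sublinear_ge _ sq))// lerN2.
  have sI : sublinear (fun x => inf [set sval q x | q in A]).
    apply: inf_sublinear => //.
      move=> i j x y Ai Aj; have [[iD _] _] := svalP i; have [[jD _] _] := svalP j.
      have [/asboolP ij|/asboolP ji] := totA _ _ Ai Aj.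
        by exists j => //; rewrite (le_trans (jD _ _))// lerD.
      by exists i => //; rewrite (le_trans (iD _ _))// lerD.
    move=> i t x Ai t0; exists i; first exact: Ai.
    by have [[_ iZ] _] := svalP i; rewrite iZ ?(ltW t0).
  have Ip x : inf [set sval q x | q in A] <= p x.
    have [q Aq] := A0; have [_ /(_ x)] := svalP q.
    by apply: le_trans; apply: ge_inf => //; exists q.
  exists (exist (fun q => sublinear q /\ forall x, q x <= p x) _ (conj sI Ip)) => s As; apply/asboolP => x /=.
  by apply: ge_inf => //; exists s.
have [sq qp] := svalP q; exists (sval q); split=> // q' sq' q'q.
have q'p x : q' x <= p x by exact: le_trans (qp x).
have /(congr1 sval) : exist (fun q => sublinear q /\ forall x, q x <= p x) q' (conj sq' q'p) = q.
  by apply: qmin; apply/asboolP.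
by [].
Qed.

(* A minimal sublinear functional [q] is additive because, for each [y],
   [inf_(t >= 0) (q (x + t y) - t q y)] is sublinear and at most [q x]. *)
Theorem Hahn_Banach p : sublinear p -> exists f : V -> R,
  (forall a x y, f (a *: x + y) = a * f x + f y) /\ forall x, f x <= p x.
Proof.
move=> /minimal_sublinear [q [sq qp qmin]]; have [qD qZ] := sq.
have qDge x y : q x + q y <= q (x + y).
  pose F t z := q (z + t *: y) - t * q y.
  have lb z : has_lbound [set F t z | t in [set t | 0 <= t]].
    exists (- q (- z)) => _ [t /= t0 <-]; rewrite /F.
    have := qD (- z) (z + t *: y); rewrite addKr qZ// => ?; lra.
  have sI : sublinear (fun z => inf [set F t z | t in [set t | 0 <= t]]).
    apply: inf_sublinear => //; first by exists 0 => /=.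
      move=> s t x' y' /= s0 t0; exists (s + t); rewrite /= ?addr_ge0// /F.
      have := qD (x' + s *: y) (y' + t *: y); rewrite addrACA -scalerDl mulrDl => ?; lra.
    move=> s t x' /= s0 t0; exists (t * s); first by rewrite /= mulr_ge0 ?(ltW t0).
    by rewrite /F -scalerA -scalerDr qZ ?(ltW t0)// mulrBr (mulrA t s).
  have Iq x' : inf [set F t x' | t in [set t | 0 <= t]] <= q x'.
    apply: ge_inf => //; exists 0 => //=.
    by rewrite /F scale0r addr0 mul0r subr0.
  (* Minimality identifies the infimum with [q]; its member at [t = 1] is [q (x + y) - q y]. *)
  have /(congr1 (fun f => f x)) <- := qmin _ sI Iq.
  rewrite -lerBrDr; apply: ge_inf => //; exists 1 => //=.
  by rewrite /F scale1r mul1r.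
have qDE x y : q (x + y) = q x + q y by apply/eqP; rewrite eq_le qD qDge.
have qN x : q (- x) = - q x.
  by apply/eqP; rewrite -addr_eq0 addrC -qDE subrr sublinear0.
exists q; split=> // a x y; rewrite qDE; congr (_ + _).
have [a0|a0] := lerP 0 a; first exact: qZ.
by rewrite -[a]opprK scaleNr qN qZ ?mulNr// oppr_ge0 ltW.
Qed.

End HahnBanach.

(** * Continuous linear functionals, convex separation and norming functionals *)

Lemma convex_setP (R : realType) (M : lmodType R) (A : set M) :
  convex_set A <->
  forall a b (t : R), A a -> A b -> 0 <= t -> t <= 1 -> A (t *: a + (1 - t) *: b).
Proof.
split=> [cA a b t Aa Ab t0 t1|cA a b t]; last by rewrite !inE => Aa Ab; exact: cA.
by have := cA a b (Itv01 t0 t1); rewrite !inE => /(_ Aa Ab).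
Qed.

Section Functionals.
Context {R : realType} {X : normedModType R}.
Implicit Types (f g : X -> R) (x y : X).

Lemma clfD f x y : is_clf f -> f (x + y) = f x + f y.
Proof. by move=> [fL _]; rewrite -[x]scale1r fL scale1r mul1r. Qed.

Lemma clf0 f : is_clf f -> f 0 = 0.
Proof. by move=> cf; have := clfD 0 0 cf; rewrite addr0 => ?; lra. Qed.

Lemma clfZ f a x : is_clf f -> f (a *: x) = a * f x.
Proof. by move=> cf; have [fL _] := cf; rewrite -[a *: x]addr0 fL clf0// addr0. Qed.

Lemma clfN f x : is_clf f -> f (- x) = - f x.
Proof. by move=> cf; rewrite -scaleN1r clfZ// mulN1r. Qed.

Lemma clfB f x y : is_clf f -> f (x - y) = f x - f y.
Proof. by move=> cf; rewrite clfD// clfN. Qed.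

Lemma bounded_clf f M :
  (forall (a : R) x y, f (a *: x + y) = a * f x + f y) ->
  (forall x, `|f x| <= M * `|x|) -> is_clf f.
Proof.
move=> fL fM; split=> // x; apply/cvgrPdist_le => /= e e0.
have fB a b : f (a - b) = f a - f b.
  by rewrite -scaleN1r addrC fL mulN1r addrC.
have M0 : 0 < `|M| + 1 by rewrite ltr_wpDl.
near=> y; rewrite -fB (le_trans (fM _))//.
rewrite (@le_trans _ _ ((`|M| + 1) * `|x - y|))//.
  by rewrite ler_wpM2r// ler_wpDr// ler_norm.
rewrite -ler_pdivlMl// mulrC; near: y.
by apply: cvgr_dist_le => //; rewrite divr_gt0.
Unshelve. all: by end_near. Qed.

Lemma clf_bounded f : is_clf f -> exists2 M, 0 <= M & forall x, `|f x| <= M * `|x|.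
Proof.
move=> cf; have [_ fc] := cf.
have /cvgrPdist_le /(_ 1 ltr01) := fc 0; rewrite clf0// => /nbhs_norm0P[d /= d0 fd].
exists (2 / d) => [|x]; first by rewrite divr_ge0// ltW.
have [->|x0] := eqVneq x 0; first by rewrite clf0// !normr0 mulr0.
have nx : 0 < `|x| by rewrite normr_gt0.
(* Rescaling [x] to norm [d / 2] puts it inside the ball of radius [d], where [f] is bounded by
   1. *)
have c0 : 0 < d / 2 / `|x| by rewrite !divr_gt0.
have := fd ((d / 2 / `|x|) *: x); rewrite /= normrZ gtr0_norm// divfK ?gt_eqF//.
rewrite sub0r normrN clfZ// normrM (gtr0_norm c0) => h.
have {}h := h ltac:(lra).
rewrite -(ler_pM2l c0) (le_trans h)//.
have -> : d / 2 / `|x| * (2 / d * `|x|) = 1 by field; rewrite !gt_eqF.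
done.
Qed.

Lemma clf_comb a f g : is_clf f -> is_clf g -> is_clf (fun x => a * f x + g x).
Proof.
move=> cf cg; have [Mf _ fM] := clf_bounded cf; have [Mg _ gM] := clf_bounded cg.
apply: (@bounded_clf _ (`|a| * Mf + Mg)) => [b x y|x].
  by rewrite !clfD// !clfZ//; lra.
rewrite (le_trans (ler_normD _ _))// mulrDl lerD// normrM -mulrA.
by rewrite ler_wpM2l.
Qed.

(* The Hahn-Banach majorant is
   [p x = inf_(t >= 0, a in A) (|x - t (a - z)| - t d)], for which
   [p (a - z) <= - d] and [p x <= |x|]. *)
Theorem convex_separation (A : set X) (z : X) (d : R) :
    A !=set0 -> convex_set A -> (forall a, A a -> d <= `|a - z|) ->
  exists f, [/\ is_clf f, forall x, `|f x| <= `|x| & forall a, A a -> f a + d <= f z].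
Proof.
move=> [a0 Aa0] cA dA.
pose F (k : R * X) x := `|x - k.1 *: (k.2 - z)| - k.1 * d.
pose D := [set k : R * X | 0 <= k.1 /\ A k.2].
(* The bound [d <= |a - z|] scaled by [t] compensates the term [- t d], so the infimum is finite. *)
have Fge k x : D k -> - `|x| <= F k x.
  case: k => t a [/= t0 Aa]; rewrite /F/=.
  have := ler_normB x (x - t *: (a - z)); rewrite subKr normrZ ger0_norm// => h.
  by have := ler_wpM2l t0 (dA _ Aa) => ?; lra.
have lb x : has_lbound [set F k x | k in D].
  by exists (- `|x|) => _ [k Dk <-]; exact: Fge.
have Fle x k : D k -> inf [set F i x | i in D] <= F k x.
  by move=> Dk; apply: ge_inf => //; exists k.
have [f [fL fp]] : exists f : X -> R, (forall a x y, f (a *: x + y) = a * f x + f y) /\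
    forall x, f x <= inf [set F k x | k in D].
  apply: Hahn_Banach; apply: inf_sublinear => //; first by exists (0, a0).
    move=> [s a] [t b] x y [/= s0 Aa] [/= t0 Ab].
    have [st0|st0] := eqVneq (s + t) 0.
      have [s00 t00] : s = 0 /\ t = 0 by split; lra.
      exists (0, a) => //; rewrite /F /= s00 t00 !scale0r !mul0r !subr0.
      exact: ler_normD.
    have st : 0 < s + t by rewrite lt_neqAle eq_sym st0 addr_ge0.
    (* The weighted mean satisfies [(s + t) c = s a + t b], so the single index [(s + t, c)]
       accounts for both summands. *)
    pose c := (s / (s + t)) *: a + (1 - s / (s + t)) *: b.
    exists (s + t, c).
      split; rewrite /= ?addr_ge0//; apply: (convex_setP A).1 => //.
        by rewrite divr_ge0// ltW.
      by rewrite ler_pdivrMr// mul1r lerDl.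
    have -> : F (s + t, c) (x + y) =
        `|(x - s *: (a - z)) + (y - t *: (b - z))| - (s * d + t * d).
      rewrite /F /=; congr (`|_| - _); last by rewrite mulrDl.
      have cE : (s + t) *: c = s *: a + t *: b.
        rewrite /c scalerDr !scalerA mulrBr mulr1 mulrCA divff// mulr1.
        by have -> : s + t - s = t by lra.
      have -> : (s + t) *: (c - z) = s *: (a - z) + t *: (b - z).
        by rewrite !scalerBr cE scalerDl opprD addrACA.
      by rewrite opprD addrACA.
    by rewrite /F /= [leRHS]addrACA -opprD lerD2r ler_normD.
  move=> [s a] t x [/= s0 Aa] t0; exists (t * s, a); first by split; rewrite //= mulr_ge0// ltW.
  by rewrite /F /= -scalerA -scalerBr normrZ gtr0_norm// mulrBr mulrA.
have f0 x : f x <= `|x|.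
  rewrite (le_trans (fp x))// (le_trans (Fle x (0, a0) _))//.
  by rewrite /F /= scale0r mul0r !subr0.
have fM x : `|f x| <= 1 * `|x|.
  rewrite mul1r ler_norml f0 andbT lerNl -(normrN x).
  have := fL (-1) x 0; rewrite scaleN1r mulN1r addr0.
  have := fL 1 0 0; rewrite scaler0 mul1r addr0 => f00.
  have -> : f 0 = 0 by lra.
  by rewrite addr0 => <-.
have cf := bounded_clf fL fM; exists f; split=> // [x|a Aa].
  by rewrite -[leRHS]mul1r.
have := fp (a - z); rewrite clfB// => h.
have := Fle (a - z) (1, a) (conj ler01 Aa).
rewrite /F /= scale1r subrr normr0 mul1r => ?; lra.
Qed.

(** Separating the singleton of 0 from [x] at distance [|x|] gives [|x| <= f x]. *)
Lemma norming_functional x :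
  exists f, [/\ is_clf f, forall y, `|f y| <= `|y| & f x = `|x|].
Proof.
have [| | |f [cf f1 fx]] := @convex_separation [set 0] x `|x|.
- by exists 0.
- by apply/convex_setP => a b t -> -> _ _; rewrite -scalerDl addrC subrK scale1r.
- by move=> _ ->; rewrite sub0r normrN.
exists f; split=> //; apply/eqP; rewrite eq_le (le_trans (ler_norm _))//.
by have := fx 0 erefl; rewrite clf0// add0r.
Qed.

End Functionals.

(** * Ultrafilter limits of real sequences and extraction of subsequences *)

Section Subsequences.

Lemma subsequence_choice (P : nat -> nat -> Prop) :
  (forall k N, exists2 n, (N <= n)%N & P k n) ->
  exists2 s : nat -> nat, (forall n, (s n < s n.+1)%N) & forall k, P k (s k).
Proof.
move=> PN.
have [h hP] : {h : nat * nat -> nat & forall kN, (kN.2 <= h kN)%N /\ P kN.1 (h kN)}.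
  by apply: (@choice _ _ (fun kN n => (kN.2 <= n)%N /\ P kN.1 n)) => -[k N]; have [n] := PN k N; exists n.
pose s := fix s n := if n is m.+1 then h (n, (s m).+1) else h (0, 0).
exists s => [n|[|k]] /=; first by have [] := hP (n.+1, (s n).+1).
  by have [] := hP (0, 0).
by have [] := hP (k.+1, (s k).+1).
Qed.

Lemma leq_subsequence (s : nat -> nat) n : (forall n, (s n < s n.+1)%N) -> (n <= s n)%N.
Proof. by move=> s1; elim: n => // n /leq_ltn_trans; apply. Qed.

Lemma subsequence_infty (s : nat -> nat) : (forall n, (s n < s n.+1)%N) -> s @ \oo --> \oo.
Proof.
move=> s1 A [N _ NA]; exists N => // n /= Nn; apply: NA => /=.
exact: leq_trans Nn (leq_subsequence n s1).
Qed.

Lemma subsequence_comp (s t : nat -> nat) :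
  (forall n, (s n < s n.+1)%N) -> (forall n, (t n < t n.+1)%N) ->
  forall n, (s (t n) < s (t n.+1))%N.
Proof.
move=> s1 t1 n.
have sm : {homo s : a b / (a < b)%N} by apply: homo_ltn => //; exact: ltn_trans.
exact: sm.
Qed.

Context {R : realType}.

Lemma not_cvg_subsequence (V : pseudoMetricNormedZmodType R) (u : nat -> V) (l : V) :
  ~ (u @ \oo --> l) -> exists e, exists s : nat -> nat,
  [/\ 0 < e, forall n, (s n < s n.+1)%N & forall k, e <= `|l - u (s k)|].
Proof.
move=> nul; apply: contrapT => h; apply: nul; apply/cvgrPdist_le => /= e e0.
apply: contrapT => ne; apply: h.
have [k N|s s1 sP] := @subsequence_choice (fun _ n => e <= `|l - u n|); last by exists e, s.
apply: contrapT => hN; apply: ne; exists N => // n /= Nn.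
by rewrite leNgt; apply/negP => /ltW en; apply: hN; exists n.
Qed.

(** Compactness of a segment provides a cluster point, and an ultrafilter converges to each of its
    cluster points. *)
Lemma ultra_cvg_bounded (T : Type) (U : set_system T) (c : T -> R) (M : R) :
  UltraFilter U -> (\forall t \near U, `|c t| <= M) -> exists l : R, c @ U --> l.
Proof.
move=> UU cM.
have [l [_ lc]] : `[- M, M] `&` cluster (c @ U) !=set0.
  apply: segment_compact; near=> t; rewrite /= in_itv/= -ler_norml.
  by near: t.
exists l => B Bl; have [//|UB] := in_ultra_setVsetC (c @^-1` B) UU.
have [x [nBx Bx]] := lc (~` B) B UB Bl.
by [].
Unshelve. all: by end_near. Qed.

(** Diagonal extraction: stage [k] imposes precision [1 / (k + 1)] only on the indices of code at
    most [k]. These finitely many conditions hold on a set of [U], which meets every tail. *)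
Lemma ultra_subsequence (I : countType) (U : set_system nat) (c : I -> nat -> R) (l : I -> R) :
  ProperFilter U -> \oo `<=` U -> (forall i, c i @ U --> l i) ->
  exists2 s : nat -> nat, (forall n, (s n < s n.+1)%N) &
    forall i, (fun n => c i (s n)) @ \oo --> l i.
Proof.
move=> UU ooU cl.
pose P k n := forall i, (pickle i <= k)%N -> `|l i - c i n| <= k.+1%:R^-1.
have [k N|s s1 sP] := @subsequence_choice P.
  have UN : U [set n | (N <= n)%N] by apply: ooU; exact: nbhs_infty_ge.
  suff UP : \forall n \near U, P k n.
    have [n [/= Nn Pn]] := filter_ex (filterI UN UP).
    by exists n.
  (* Ranging over codes makes this a finite intersection; a code of no index imposes nothing. *)
  have : \forall n \near U, forall j : 'I_k.+1, forall i, pickle i = j -> `|l i - c i n| <= k.+1%:R^-1.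
    apply: filter_forall => j.
    have [[i0 <-]|nj] := pselect (exists i : I, pickle i = j); last first.
      by apply: nearW => n i ij; case: nj; exists i.
    have /cvgrPdist_le /(_ k.+1%:R^-1) := cl i0; rewrite invr_gt0 ltr0n => /(_ isT).
    by apply: filterS => n cn i /(pcan_inj pickleK) ->.
  by apply: filterS => n h i ik; exact: (h (Ordinal (ik : (pickle i < k.+1)%N))).
exists s => // i; apply/cvgrPdist_le => /= e e0; near=> n.
rewrite (le_trans (sP n i _))//; first by near: n; exact: nbhs_infty_ge.
by rewrite ltW//; near: n; exact: near_infty_natSinv_lt (PosNum e0).
Unshelve. all: by end_near. Qed.

End Subsequences.

(** * Weak limits along filters *)

Section WeakLimits.
Context {R : realType} {X : normedModType R}.
Implicit Types (f g : X -> R) (x y : X) (T : Type).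

Lemma clf_separates x y : (forall f, is_clf f -> f x = f y) -> x = y.
Proof.
move=> fxy; have [f [cf _ fn]] := norming_functional (x - y).
by apply/eqP; rewrite -subr_eq0 -normr_eq0 -fn clfB// (fxy f)// subrr.
Qed.

Lemma closureP (A : set X) y : closure A y <-> forall e, 0 < e -> exists2 a, A a & `|y - a| <= e.
Proof.
split=> [cA e e0|h B /nbhs_normP[e /= e0 eB]].
  have [a [Aa]] := cA _ (nbhsx_ballx y e e0).
  by rewrite -ball_normE /= => /ltW; exists a.
have [a Aa ya] := h (e / 2) ltac:(lra); exists a; split=> //; apply: eB => /=.
by rewrite (le_lt_trans ya)//; lra.
Qed.

(** [weakly_to] is the case of the filter [\oo]; general filters make room for ultrafilters. *)
Definition weak_limit T (F : set_system T) (u : T -> X) x : Prop :=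
  forall f, is_clf f -> (f \o u) @ F --> f x.

(** Mazur's theorem: a point outside a closed convex set lies at positive distance [e] from it, and
    the gap [e] of a separating functional survives in the limit. *)
Lemma weak_limit_closed_convex T (F : set_system T) (u : T -> X) x (A : set X) :
  ProperFilter F -> closed A -> convex_set A -> (\forall t \near F, A (u t)) ->
  weak_limit F u x -> A x.
Proof.
move=> FF Acl Acv Au ux; apply: contrapT => nAx; apply: nAx.
apply: contrapT => nAx.
have [e e0 Ae] : exists2 e, 0 < e & forall a, A a -> e <= `|a - x|.
  apply: contrapT => h; apply: nAx; rewrite (closure_id A).1//; apply/closureP => e e0.
  apply: contrapT => h'; apply: h; exists e => // a Aa.
  by rewrite leNgt; apply/negP => ae; apply: h'; exists a => //; rewrite distrC ltW.
have A0 : A !=set0 by have [t At] := filter_ex Au; exists (u t).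
have [f [cf _ fA]] := convex_separation A0 Acv Ae.
have : f x <= f x - e.
  apply: (cvgr_to_le (ux f cf)); apply: filterS Au => t /fA /=; lra.
lra.
Qed.

(** Weak lower semicontinuity of the norm, obtained by testing against the functional norming
    [x]. *)
Lemma le_norm_weak_limit T (F : set_system T) (u : T -> X) x (M : R) :
  ProperFilter F -> weak_limit F u x -> (\forall t \near F, `|u t| <= M) -> `|x| <= M.
Proof.
move=> FF ux uM; have [f [cf f1 <-]] := norming_functional x.
apply: (cvgr_to_le (ux f cf)); apply: filterS uM => t /=; apply: le_trans.
exact: le_trans (ler_norm _) (f1 _).
Qed.

Lemma reflexive_ultra_limit T (U : set_system T) (u : T -> X) (K : R) :
  @reflexive_space R X -> UltraFilter U -> (\forall t \near U, `|u t| <= K) ->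
  exists x, weak_limit U u x.
Proof.
move=> refl UU uK.
(* A nonzero vector is what forces [0 <= M] whenever [|f x| <= M |x|] for all [x]; the zero space is
   therefore treated apart. *)
have [X0|/existsNP[x1 /eqP x1_neq0]] := pselect (forall x : X, x = 0).
  exists 0 => f cf; suff -> : f \o u = cst (f 0) by exact: cvg_cst.
  by apply/funext => t /=; rewrite (X0 (u t)).
have fl f : is_clf f -> (f \o u) @ U --> lim ((f \o u) @ U).
  move=> cf; have [M M0 fM] := clf_bounded cf.
  have [|l fl] := @ultra_cvg_bounded R T U (f \o u) (M * K) UU.
    by apply: filterS uK => t uK; rewrite (le_trans (fM _))// ler_wpM2l.
  by apply/cvg_ex; exists l.
have [| |x xP] := refl (fun f => lim ((f \o u) @ U)).
- move=> a f g cf cg; apply: cvg_lim => //.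
  apply: cvgD; last exact: fl.
  by apply: cvgM; [exact: cvg_cst|exact: fl].
- exists K => f M cf fM; apply: (cvgr_to_le (cvg_norm (fl f cf))).
  have M0 : 0 <= M.
    have := le_trans (normr_ge0 _) (fM x1).
    by rewrite pmulr_lge0// normr_gt0.
  by apply: filterS uK => t uK; rewrite (le_trans (fM _))// mulrC ler_wpM2r.
by exists x => f cf; rewrite -(xP f cf); exact: fl.
Qed.

End WeakLimits.

(** * Weakly convergent subsequences and the Kadec-Klee property off the unit sphere *)

Section WeakSubsequences.
Context {R : realType} {X : normedModType R}.
Implicit Types (f g : X -> R) (x y : X).

Section RationalSpan.
Variable u : nat -> X.

(** Polynomials over [rat] encode finitely supported rational coefficients by a countable type with
    vector operations. *)
Definition ratcomb (p : {poly rat}) : X := \sum_(i < size p) ratr p`_i *: u i.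

Lemma ratcomb_widen n (p : {poly rat}) : (size p <= n)%N -> ratcomb p = \sum_(i < n) ratr p`_i *: u i.
Proof.
move=> pn; rewrite /ratcomb (big_ord_widen n (fun i => (ratr p`_i : R) *: u i))//.
rewrite [RHS](bigID (fun i : 'I_n => (i < size p)%N)) /= [X in _ = _ + X]big1 ?addr0// => i.
by rewrite -leqNgt => /(nth_default 0) ->; rewrite rmorph0 scale0r.
Qed.

Lemma ratcombP a (p q : {poly rat}) : ratcomb (a *: p + q) = ratr a *: ratcomb p + ratcomb q.
Proof.
pose n := maxn (size (a *: p + q)) (maxn (size p) (size q)).
rewrite !(@ratcomb_widen n) ?leq_max ?leqnn ?orbT// scaler_sumr -big_split /=.
by apply: eq_bigr => i _; rewrite coefD coefZ rmorphD rmorphM scalerDl scalerA.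
Qed.

Lemma ratcombX n : ratcomb 'X^n = u n.
Proof.
rewrite (@ratcomb_widen n.+1) ?size_polyXn// (bigD1 ord_max)//= coefXn eqxx rmorph1 scale1r.
rewrite big1 ?addr0// => i /negbTE; rewrite -val_eqE /= => ni.
by rewrite coefXn ni rmorph0 scale0r.
Qed.

Lemma convex_closure_ratcomb : convex_set (closure (range ratcomb)).
Proof.
apply/convex_setP => x y t /closureP cx /closureP cy t0 t1; apply/closureP => e e0.
have [_ [p _ <-] xp] := cx (e / 2) ltac:(lra).
have [_ [q _ <-] yq] := cy (e / 2) ltac:(lra).
pose M := `|ratcomb p - ratcomb q| + 1.
have M0 : 0 < M by rewrite ltr_wpDl.
have [r] : exists r : rat, ratr r \in `]t, t + e / 2 / M[.
  by apply: rat_in_itvoo; rewrite ltrDl !divr_gt0.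
rewrite in_itv /= => /andP[tr re].
exists (ratcomb (r *: (p - q) + q)); first by exists (r *: (p - q) + q).
rewrite ratcombP.
have -> : ratcomb (p - q) = ratcomb p - ratcomb q.
  have := ratcombP (-1) q p; rewrite scaleN1r addrC => ->.
  by rewrite rmorphN1 scaleN1r addrC.
set P := ratcomb p; set Q := ratcomb q.
have -> : t *: x + (1 - t) *: y - (ratr r *: (P - Q) + Q) =
   t *: (x - P) + (1 - t) *: (y - Q) - (ratr r - t) *: (P - Q).
  have tPQ : t *: (x - P) + (1 - t) *: (y - Q) =
      t *: x + (1 - t) *: y - (t *: (P - Q) + Q).
    rewrite !scalerBr addrACA -opprD; congr (_ - _).
    by rewrite scalerBl scale1r -addrA [Q - _]addrC.
  rewrite tPQ -[RHS]addrA -opprD; congr (_ - _).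
  by rewrite [RHS]addrC addrA -scalerDl subrK.
rewrite (le_trans (ler_normB _ _))// (le_trans (lerD (ler_normD _ _) (lexx _)))//.
rewrite !normrZ (ger0_norm t0) (@ger0_norm _ (1 - _)) ?subr_ge0// (@ger0_norm _ (_ - t)) ?subr_ge0 ?(ltW tr)//.
have : (ratr r - t) * `|P - Q| <= e / 2.
  rewrite (@le_trans _ _ ((e / 2 / M) * M))//; last by rewrite divfK// gt_eqF.
  by rewrite ler_pM// ?subr_ge0 ?(ltW tr)//; [lra|rewrite /M lerDl].
have := ler_wpM2l t0 xp; have := @ler_wpM2l _ (1 - t) ltac:(lra) _ _ yq.
lra.
Qed.

(* Norming functionals of the countably many rational combinations of [u]
   separate the points of the closed span of [u]. *)
Lemma countable_separating_family : exists (Y : set X) (g : {poly rat} -> X -> R),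
  [/\ convex_set Y, closed Y, forall n, Y (u n), forall p, is_clf (g p) &
      forall x y, Y x -> Y y -> (forall p, g p x = g p y) -> x = y].
Proof.
have [g gP] := choice (fun p => norming_functional (ratcomb p)).
exists (closure (range ratcomb)), g; split.
- exact: convex_closure_ratcomb.
- exact: closed_closure.
- by move=> n; apply: subset_closure; exists 'X^n => //; exact: ratcombX.
- by move=> p; have [] := gP p.
move=> x y /closureP cx /closureP cy gxy.
apply/eqP; rewrite -subr_eq0 -normr_le0; apply/ler_addgt0Pl => e e0; rewrite addr0.
have [_ [p _ <-] xp] := cx (e / 4) ltac:(lra).
have [_ [q _ <-] yq] := cy (e / 4) ltac:(lra).
have pq : ratcomb (p - q) = ratcomb p - ratcomb q.
  have := ratcombP (-1) q p; rewrite scaleN1r addrC => ->.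
  by rewrite rmorphN1 scaleN1r addrC.
have [cg g1 gn] := gP (p - q).
have d : `|(x - y) - ratcomb (p - q)| <= e / 2.
  have -> : x - y - ratcomb (p - q) = (x - ratcomb p) - (y - ratcomb q).
    by rewrite pq !opprB addrACA [- y - _]addrC addrACA.
  by rewrite (le_trans (ler_normB _ _))//; lra.
(* The functional norming [w = ratcomb (p - q)] vanishes at [x - y], so
   [|w| <= |w - (x - y)| <= e / 2], and [|x - y| <= e] follows. *)
have := g1 (ratcomb (p - q) - (x - y)); rewrite clfB// (clfB _ _ cg) gxy subrr subr0 gn normr_id distrC => h.
have := ler_normB (x - y) (x - y - ratcomb (p - q)); rewrite subKr => h2.
have := ler_normD (ratcomb (p - q)) (x - y - ratcomb (p - q)); rewrite addrC subrK => h3.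
lra.
Qed.

End RationalSpan.

(* Ultrafilter version of the Eberlein-Smulian theorem: on the closed span of
   [u] a countable family of functionals determines the weak limits. *)
Lemma reflexive_weak_subsequence (U : set_system nat) (u : nat -> X) x (c : nat -> R) (a K : R) :
    @reflexive_space R X -> UltraFilter U -> \oo `<=` U ->
    (forall n, `|u n| <= K) -> weak_limit U u x -> c @ U --> a ->
  exists s : nat -> nat, [/\ forall n, (s n < s n.+1)%N, weakly_to (u \o s) x &
    (c \o s) @ \oo --> a].
Proof.
move=> refl UU ooU uK ux ca.
have [Y [g [Ycv Ycl Yu cg gsep]]] := countable_separating_family u.
(* The index [None] carries the scalar sequence, so that one extraction serves it and all the
   functionals. *)
pose cc (i : option {poly rat}) := if i is Some p then g p \o u else c.
pose ll (i : option {poly rat}) := if i is Some p then g p x else a.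
have [|s s1 sl] := @ultra_subsequence R _ U cc ll _ ooU.
  by case=> [p|//]; exact: ux.
exists s; split=> //; last exact: (sl None).
(* Otherwise [f] stays [e] away from [f x] along a further subsequence. Its weak [U]-limit [y] lies
   in [Y] and agrees with [x] under every [g p], hence equals [x]. *)
move=> f cf; apply: contrapT => /not_cvg_subsequence[e [t [e0 t1 te]]].
have [y wy] : exists y, weak_limit U (u \o s \o t) y.
  by apply: (reflexive_ultra_limit refl UU (K := K)); apply: nearW => n; exact: uK.
have Yx : Y x by apply: (weak_limit_closed_convex _ Ycl Ycv _ ux); exact: nearW.
have Yy : Y y by apply: (weak_limit_closed_convex _ Ycl Ycv _ wy); apply: nearW => n /=.
have yx : y = x.
  apply: gsep => // p.
  have h : (fun n => g p (u (s (t n)))) @ \oo --> g p x.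
    exact: (cvg_comp _ _ (subsequence_infty t1) (sl (Some p))).
  have h' : (fun n => g p (u (s (t n)))) @ U --> g p x.
    by apply: cvg_trans h => A /ooU.
  exact: (norm_cvg_unique (wy _ (cg p)) h').
have := wy f cf; rewrite yx => /cvgrPdist_lt /(_ e e0) /filter_ex [n] /=.
by rewrite ltNge => /negP; apply; exact: te.
Qed.

(** For a nonzero limit, the property is applied to the normalised sequence and the convergent norms
    are multiplied back. *)
Lemma kadec_klee_cvg (z : nat -> X) x : @kadec_klee R X -> weakly_to z x ->
  (fun n => `|z n|) @ \oo --> `|x| -> z @ \oo --> x.
Proof.
move=> KK zx nzx.
have [x0|x0] := eqVneq x 0.
  by move: nzx; rewrite x0 normr0 => /norm_cvg0P.
have nx0 : `|x| != 0 by rewrite normr_eq0.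
(* The default [x / |x|] keeps every term on the unit sphere; it is used only finitely often. *)
pose w n := if z n == 0 then `|x|^-1 *: x else `|z n|^-1 *: z n.
have zn0 : \forall n \near \oo, z n != 0.
  have : \forall n \near \oo, 0 < `|z n|.
    by apply: (cvgr_gt _ nzx); rewrite normr_gt0.
  by apply: filterS => n; rewrite normr_gt0.
have wcvg : w @ \oo --> `|x|^-1 *: x.
  apply: KK.
  - by rewrite normrZ normfV normr_id mulVf.
  - move=> n; rewrite /w; case: eqVneq => [_|zn]; rewrite normrZ normfV normr_id mulVf//.
    by rewrite normr_eq0.
  move=> f cf; rewrite clfZ//.
  have h : (fun n => `|z n|^-1 * f (z n)) @ \oo --> `|x|^-1 * f x.
    by apply: cvgM; [exact: cvgV|exact: zx].
  apply: cvg_trans h; apply: near_eq_cvg; apply: filterS zn0 => n zn.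
  by rewrite /w (negbTE zn) clfZ.
have : (fun n => `|z n| *: w n) @ \oo --> `|x| *: (`|x|^-1 *: x) by exact: cvgZ.
rewrite scalerA divff// scale1r; apply: cvg_trans; apply: near_eq_cvg.
apply: filterS zn0 => n zn; rewrite /w (negbTE zn) scalerA divff ?scale1r//.
by rewrite normr_eq0.
Qed.

End WeakSubsequences.

(** * Compactness of minimizing sequences in reflexive Kadec-Klee spaces *)

Lemma SACP_of_reflexive_kadec_klee (R : realType) (X : normedModType R) (V : set X) :
  @reflexive_space R X -> @kadec_klee R X ->
  closed V -> convex_set V -> SACP_cwmc V.
Proof.
move=> refl KK Vcl Vcv N x N0 _ f [f0 _ _ fs fc] v Vv rv.
have [U [UU ooU]] := @ultraFilterLemma _ (\oo : set_system nat) _.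
have [K fK] := fc (Defs.rad f x V + 1).
pose nv (v : X) := fun i => `|v - x i|.
have nvge w : nonneg_vec (nv w) by move=> i; exact: normr_ge0.
(* Past [m] the values stay below the radius plus 1, where coercivity bounds the distances by [K];
   [w] is the sequence shifted by [m]. *)
have [m _ mP] : \forall n \near \oo, r_f f x (v n) < Defs.rad f x V + 1.
  by apply: (cvgr_lt _ rv); rewrite ltrDl.
pose w n := v (n + m).
have wK i n : `|w n - x i| <= K.
  rewrite leNgt; apply/negP => Kw.
  have := mP (n + m) (leq_addl _ _); rewrite ltNge => /negP; apply; apply: ltW.
  apply: fK => //; apply: lt_le_trans Kw _.
  exact: (@le_bigmax _ _ _ 0 (fun i => `|w n - x i|) i).
have rw : (fun n => r_f f x (w n)) @ U --> Defs.rad f x V.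
  have : (fun n => r_f f x (w n)) @ \oo --> Defs.rad f x V.
    exact: (cvg_comp _ _ (cvg_addnr m) rv).
  by apply: cvg_trans => A /ooU.
have [y wy] : exists y, weak_limit U w y.
  pose i0 := Ordinal N0.
  apply: (reflexive_ultra_limit refl UU (K := K + `|x i0|)); apply: nearW => n.
  by rewrite -[w n](subrK (x i0)) (le_trans (ler_normD _ _))// lerD2r.
have Vy : V y.
  by apply: (weak_limit_closed_convex _ Vcl Vcv _ wy); apply: nearW => n; exact: Vv.
have [a aP] : exists a : 'I_N -> R, forall i, (fun n => `|w n - x i|) @ U --> a i.
  have [a aP] := choice (fun i => ultra_cvg_bounded (c := fun n => `|w n - x i|) (M := K) UU ltac:(apply: nearW => n; rewrite normr_id; exact: wK)).
  by exists a.
have wyx i : weak_limit U (fun n => w n - x i) (y - x i).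
  move=> g cg; have : (fun n => g (w n) - g (x i)) @ U --> g y - g (x i).
    by apply: cvgB; [exact: wy|exact: cvg_cst].
  by rewrite clfB//; apply: cvg_trans; apply: near_eq_cvg; apply: nearW => n /=; rewrite clfB.
have [i yi] : exists i, a i <= `|y - x i|.
  apply: contrapT => /forallNP ya; have {}ya i : `|y - x i| < a i.
    by rewrite ltNge; apply/negP; exact: ya.
  pose b i := (`|y - x i| + a i) / 2.
  have yb i : `|y - x i| < b i by rewrite /b; have := ya i; lra.
  have b0 : nonneg_vec b by move=> i; rewrite (le_trans _ (ltW (yb i))).
  have fb : f (nv y) < f b by exact: fs.
  have radV : Defs.rad f x V <= f (nv y).
    apply: ge_inf; last by exists y.
    by exists 0 => _ [z _ <-]; exact: f0.
  have : f b <= Defs.rad f x V.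
    apply: (cvgr_to_ge rw).
    have : \forall n \near U, forall i, b i < `|w n - x i|.
      apply: filter_forall => i; apply: (cvgr_gt _ (aP i)).
      by rewrite /b; have := ya i; lra.
    by apply: filterS => n bn; rewrite ltW//; apply: fs.
  lra.
(* Weak lower semicontinuity gives the reverse inequality. Convergence of the distances to this one
   centre suffices for Kadec-Klee. *)
have ai : a i = `|y - x i|.
  apply/eqP; rewrite eq_le yi /=; apply/ler_addgt0Pl => e e0.
  apply: (le_norm_weak_limit _ (wyx i)).
  have /cvgrPdist_le /(_ e e0) := aP i; apply: filterS => n /=; rewrite ler_norml => /andP[]; lra.
have [s [s1 sw sa]] := reflexive_weak_subsequence (c := fun n => `|w n - x i|) refl UU ooU (wK i) (wyx i) (aP i).
have zc : (fun n => w (s n) - x i) @ \oo --> y - x i.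
  by apply: kadec_klee_cvg => //; rewrite -ai.
exists (fun n => s n + m)%N, y; split => [n|]; first by rewrite ltn_add2r.
have : (fun n => w (s n) - x i + x i) @ \oo --> y - x i + x i.
  by apply: cvgD => //; exact: cvg_cst.
rewrite subrK; apply: cvg_trans; apply: near_eq_cvg; apply: nearW => n /=.
by rewrite subrK.
Qed.

(** * Compactness of slices and the Kadec-Klee property from SACP *)

Section ConverseCompactness.
Context {R : realType} {X : normedModType R}.
Hypothesis sacp : forall V : set X, V !=set0 -> closed V -> convex_set V -> SACP_cwmc V.
Implicit Types (f g : X -> R).

(** With 0 as the only centre, this function turns [r_f] into the norm. *)
Lemma F_cwmc_coord0 : F_cwmc (fun phi : 'I_1 -> R => phi ord0).
Proof.
split=> [phi phi0|//|phi1 phi2 _ _ le12|phi1 phi2 _ _ lt12|M].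
- exact: phi0.
- exact: le12.
- exact: lt12.
by exists M => phi phi0; rewrite big_ord_recl big_ord0 max_l.
Qed.

(* The normalised sequence [x n / f (x n)] minimises the norm over the
   hyperplane [f = 1]. *)
Lemma slice_subsequence f (x : nat -> X) (r : R) : is_clf f -> (forall y, `|f y| <= `|y|) -> 0 < r ->
  (f \o x) @ \oo --> r -> (fun n => `|x n|) @ \oo --> r ->
  exists (s : nat -> nat) (y : X), (forall n, (s n < s n.+1)%N) /\ (x \o s) @ \oo --> y.
Proof.
move=> cf f1 r0 fx nx; pose V := [set v | f v = 1].
have fx0 : \forall n \near \oo, 0 < f (x n) by exact: (cvgr_gt _ fx).
have [n0 /= fn0] := filter_ex fx0.
(* The finitely many terms that cannot be normalised are replaced by a fixed point of the
   hyperplane. *)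
pose w n := if 0 < f (x n) then (f (x n))^-1 *: x n else (f (x n0))^-1 *: x n0.
have Vw n : V (w n).
  by rewrite /V /w /=; case: ifP => [fn|_]; rewrite clfZ// mulVf// gt_eqF.
have Vcv : convex_set V.
  apply/convex_setP => a b t; rewrite /V /= => fa fb _ _.
  by rewrite (clfD _ _ cf) (clfZ t _ cf) (clfZ (1 - t) _ cf) fa fb; lra.
have Vcl : closed V.
  apply: (@preimage_closed _ _ f [set 1]) => [y _|]; last exact: closed_eq.
  by have [_ +] := cf; apply.
have V1 v : V v -> 1 <= `|v| by move=> /= <-; exact: le_trans (ler_norm _) (f1 v).
pose x0 := fun _ : 'I_1 => 0 : X.
pose F := fun phi : 'I_1 -> R => phi ord0.
have wcvg : (fun n => r_f F x0 (w n)) @ \oo --> (1 : R).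
  have : (fun n => (f (x n))^-1 * `|x n|) @ \oo --> r^-1 * r.
    by apply: cvgM => //; apply: cvgV => //; rewrite gt_eqF.
  rewrite mulVf ?gt_eqF//; apply: cvg_trans; apply: near_eq_cvg.
  apply: filterS fx0 => n fn; rewrite /r_f /F /x0 subr0 /w fn normrZ gtr0_norm//.
  by rewrite invr_gt0.
have rad1 : Defs.rad F x0 V = 1.
  have lbV : lbound [set r_f F x0 v | v in V] 1.
    by move=> _ [v Vv <-]; rewrite /r_f /F /x0 subr0; exact: V1.
  apply/eqP; rewrite eq_le; apply/andP; split.
    apply: (cvgr_to_ge wcvg); apply: nearW => n; apply: ge_inf; first by exists 1.
    by exists (w n).
  by apply: lb_le_inf => //; exists (r_f F x0 (w n0)), (w n0).
have [|||s [y [s1 wy]]] := sacp (V := V) _ Vcl Vcv (x := x0) isT _ F_cwmc_coord0 Vw.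
- by exists (w n0).
- by move=> i j _; rewrite !ord1.
- by rewrite rad1.
exists s, (r *: y); split=> //.
have : (fun n => f (x (s n)) *: w (s n)) @ \oo --> r *: y.
  by apply: cvgZ => //; exact: (cvg_comp _ _ (subsequence_infty s1) fx).
apply: cvg_trans; apply: near_eq_cvg.
have := (cvg_comp _ _ (subsequence_infty s1) fx) => /cvgr_gt /(_ 0 r0).
by apply: filterS => n /= fn; rewrite /w fn scalerA divff ?scale1r// gt_eqF.
Qed.

(** The functional norming [x] tends to 1 along every subsequence of [u], so each has a
    norm-convergent subsequence, whose limit must be the weak limit [x]. *)
Lemma kadec_klee_of_SACP : @kadec_klee R X.
Proof.
move=> u x x1 u1 ux; apply: contrapT => /not_cvg_subsequence[e [s [e0 s1 se]]].
have [f [cf f1 fx]] := norming_functional x.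
have us : weakly_to (u \o s) x.
  by move=> g cg; exact: (cvg_comp _ _ (subsequence_infty s1) (ux g cg)).
have [||t [y [t1 ty]]] := @slice_subsequence f (u \o s) 1 cf f1 ltr01.
- by rewrite -x1 -fx; exact: us.
- by rewrite (_ : (fun _ => _) = cst 1) ?cvg_cst//; [exact: cvg_cst|apply/funext => n /=].
have yx : y = x.
  apply: clf_separates => g cg.
  have gy : (g \o (u \o s \o t)) @ \oo --> g y.
    by apply: continuous_cvg => //; have [_ +] := cg; apply.
  apply: (norm_cvg_unique gy).
  exact: (cvg_comp _ _ (subsequence_infty t1) (us g cg)).
move: ty; rewrite yx => /cvgrPdist_lt /(_ e e0) /filter_ex [n] /=.
by rewrite ltNge => /negP; apply; exact: se.
Qed.

End ConverseCompactness.

(** * Elements of the bidual: Ekeland's principle and Helly's theorem *)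

Section Bidual.
Context {R : realType} {X : normedModType R}.
Implicit Types (f g h : X -> R).
Variables (Phi : (X -> R) -> R) (C : R).
Hypothesis PhiL : forall (a : R) f g, is_clf f -> is_clf g ->
  Phi (fun x => a * f x + g x) = a * Phi f + Phi g.
Hypothesis PhiC : forall f (M : R), is_clf f -> (forall x, `|f x| <= M * `|x|) -> `|Phi f| <= C * M.

Lemma clf_cst0 : is_clf (fun _ : X => 0 : R).
Proof. by apply: (@bounded_clf _ _ _ 0) => [a x y|x]; rewrite ?mulr0 ?addr0// normr0 mul0r. Qed.

Lemma Phi_cst0 : Phi (fun=> 0) = 0.
Proof.
apply/eqP; rewrite -normr_le0; have := @PhiC (fun=> 0) 0 clf_cst0; rewrite mulr0; apply.
by move=> x; rewrite normr0 mul0r.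
Qed.

Lemma PhiZ a f : is_clf f -> Phi (fun x => a * f x) = a * Phi f.
Proof.
move=> cf; rewrite -[RHS]addr0 -Phi_cst0 -PhiL//; last exact: clf_cst0.
by congr Phi; apply/funext => x; rewrite addr0.
Qed.

Lemma PhiB f g : is_clf f -> is_clf g -> Phi f - Phi g = Phi (fun x => f x - g x).
Proof.
move=> cf cg; rewrite addrC -mulN1r -PhiL//; congr Phi.
by apply/funext => x; rewrite mulN1r addrC.
Qed.

Lemma clf_sum (I : Type) (r : seq I) (a : I -> R) (G : I -> X -> R) : (forall i, is_clf (G i)) ->
  is_clf (fun x => \sum_(i <- r) a i * G i x).
Proof.
move=> cG; elim: r => [|i r IH].
  by under eq_fun do rewrite big_nil; exact: clf_cst0.
by under eq_fun do rewrite big_cons; exact: clf_comb.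
Qed.

Lemma Phi_sum (I : Type) (r : seq I) (a : I -> R) (G : I -> X -> R) : (forall i, is_clf (G i)) ->
  Phi (fun x => \sum_(i <- r) a i * G i x) = \sum_(i <- r) a i * Phi (G i).
Proof.
move=> cG; elim: r => [|i r IH].
  by under eq_fun do rewrite big_nil; rewrite big_nil Phi_cst0.
by under eq_fun do rewrite big_cons; rewrite big_cons PhiL// ?IH//; exact: clf_sum.
Qed.

Definition dual_ball f := is_clf f /\ forall x, `|f x| <= `|x|.

Lemma Phi_dual_ball f : dual_ball f -> Phi f <= C.
Proof.
move=> [cf f1]; rewrite (le_trans (ler_norm _))// -[C]mulr1; apply: PhiC => // x.
by rewrite mul1r.
Qed.

(* Ekeland's variational principle for [Phi] on the dual unit ball; [above f]
   is the usual Bishop-Phelps order, the dual norm being unfolded pointwise. *)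
Lemma dual_ball_ekeland e : 0 < e -> exists2 f, dual_ball f &
  forall h M, dual_ball h -> 0 <= M -> (forall x, `|h x - f x| <= M * `|x|) ->
    Phi h - Phi f <= e * M.
Proof.
move=> e0.
pose above f h := [/\ dual_ball h, Phi f <= Phi h &
  forall x, e * `|h x - f x| <= (Phi h - Phi f) * `|x|].
have above_refl f : dual_ball f -> above f f.
  by move=> bf; split=> // x; rewrite !subrr normr0 mulr0 mul0r.
have above_trans f g h : above f g -> above g h -> above f h.
  move=> [bg fg fgx] [bh gh ghx]; split=> //; first exact: le_trans gh.
  move=> x; have -> : h x - f x = (h x - g x) + (g x - f x) by lra.
  have := ler_wpM2l (ltW e0) (ler_normD (h x - g x) (g x - f x)).
  have := fgx x; have := ghx x; lra.
(* The chosen [h] realises at least half of the supremal gain of [Phi] above [f]. *)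
have step f : exists h, dual_ball f -> above f h /\
    forall k, above f k -> Phi k - Phi f <= 2 * (Phi h - Phi f).
  have [bf|nbf] := pselect (dual_ball f); last by exists f.
  pose S := [set Phi k | k in above f].
  have hS : has_sup S.
    split; first by exists (Phi f), f => //; exact: above_refl.
    by exists C => _ [k [bk _ _] <-]; exact: Phi_dual_ball.
  have Sub k : above f k -> Phi k <= sup S.
    by move=> fk; apply: sup_upper_bound => //; exists k.
  have [fS|fS] := lerP (sup S) (Phi f).
    exists f => _; split; first exact: above_refl.
    by move=> k /Sub ?; lra.
  have [|_ [h fh <-] hS2] := @sup_adherent _ S ((sup S - Phi f) / 2) _ hS; first by lra.
  by exists h => _; split=> // k /Sub ?; lra.
have [nx nxP] := choice step.
pose F := fix F n := if n is m.+1 then nx (F m) else (fun=> 0 : R).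
have bF n : dual_ball (F n).
  elim: n => [|n /nxP[[]]//]; split; first exact: clf_cst0.
  by move=> x; rewrite normr0.
have FS n : above (F n) (F n.+1) by have [] := nxP _ (bF n).
have Fle n m : (n <= m)%N -> above (F n) (F m).
  move=> /subnK <-; elim: (m - n)%N => [|k IH]; first exact: above_refl.
  exact: above_trans IH (FS _).
have [U [UU ooU]] := @ultraFilterLemma _ (\oo : set_system nat) _.
have [f fP] : {f : X -> R & forall x, (fun n => F n x) @ U --> f x}.
  apply: (@choice _ _ (fun x l => (fun n => F n x) @ U --> l)) => x.
  apply: (@ultra_cvg_bounded _ _ U _ `|x|) => //; apply: nearW => n.
  by have [_] := bF n.
have [s sP] : exists s : R, (fun n => Phi (F n)) @ U --> s.
  apply: (@ultra_cvg_bounded _ _ U _ C) => //; apply: nearW => n.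
  have [cF F1] := bF n; rewrite -[C]mulr1; apply: PhiC => // x.
  by rewrite mul1r.
have Ule n : \forall m \near U, (n <= m)%N by apply: ooU; exact: nbhs_infty_ge.
have PhiFs n : Phi (F n) <= s.
  by apply: (cvgr_to_ge sP); apply: filterS (Ule n) => m /Fle[].
have bf : dual_ball f.
  have f1 x : `|f x| <= `|x|.
    apply: (cvgr_to_le (cvg_norm (fP x))); apply: nearW => n.
    by have [_] := bF n.
  split=> //; apply: (@bounded_clf _ _ _ 1) => [a x y|x]; last by rewrite mul1r.
  have : (fun n => a * F n x + F n y) @ U --> a * f x + f y.
    by apply: cvgD => //; apply: cvgM => //; exact: cvg_cst.
  apply: norm_cvg_unique; apply: cvg_trans (fP (a *: x + y)).
  apply: near_eq_cvg; apply: nearW => n /=.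
  by have [[FL _] _] := bF n; rewrite FL.
have fF n x : e * `|f x - F n x| <= (s - Phi (F n)) * `|x|.
  have h1 : (fun m => e * `|F m x - F n x|) @ U --> e * `|f x - F n x|.
    apply: cvgM; first exact: cvg_cst.
    by apply: cvg_norm; apply: cvgB => //; exact: cvg_cst.
  have h2 : (fun m => (Phi (F m) - Phi (F n)) * `|x|) @ U --> (s - Phi (F n)) * `|x|.
    by apply: cvgM; [apply: cvgB => //; exact: cvg_cst|exact: cvg_cst].
  by apply: (ler_cvg_to h1 h2); apply: filterS (Ule n) => m /Fle[_ _].
(* Pointwise convergence alone does not pass through [Phi]; [fF] bounds the dual norm of [f - F n]
   by [(s - Phi (F n)) / e], which tends to 0. *)
have Phif : Phi f = s.
  have h1 : (fun n => `|Phi f - Phi (F n)|) @ U --> `|Phi f - s|.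
    by apply: cvg_norm; apply: cvgB => //; exact: cvg_cst.
  have h2 : (fun n => C / e * (s - Phi (F n))) @ U --> C / e * (s - s).
    by apply: cvgM; [exact: cvg_cst|apply: cvgB => //; exact: cvg_cst].
  apply/eqP; rewrite -subr_eq0 -normr_le0.
  have -> : 0 = C / e * (s - s) by rewrite subrr mulr0.
  apply: (ler_cvg_to h1 h2); apply: nearW => n.
  have [cF _] := bF n; have [cf _] := bf.
  rewrite PhiB// -mulrA; apply: PhiC.
    have -> : (fun x => f x - F n x) = (fun x => -1 * F n x + f x).
      by apply/funext => x; rewrite mulN1r addrC.
    exact: clf_comb.
  by move=> x; rewrite -(ler_pM2l e0) !mulrA divff ?gt_eqF// mul1r.
have aboveF n : above (F n) f by split=> [//||x]; rewrite Phif; [exact: PhiFs|exact: fF].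
(* A violating [h] would lie above [f], hence above every [F n]; the half-gain choice then forces
   [Phi h <= s = Phi f]. *)
exists f => // h M bh M0 hf; rewrite leNgt; apply/negP => eM.
have afh : above f h.
  split=> // [|x]; first by have := mulr_ge0 (ltW e0) M0; lra.
  rewrite (le_trans (ler_wpM2l (ltW e0) (hf x)))// mulrA.
  by rewrite ler_wpM2r// ltW.
have : Phi h - s <= 0.
  have h1 : (fun n => Phi h - Phi (F n)) @ U --> Phi h - s.
    by apply: cvgB => //; exact: cvg_cst.
  have h2 : (fun n => 2 * (s - Phi (F n))) @ U --> 2 * (s - s).
    by apply: cvgM; [exact: cvg_cst|apply: cvgB => //; exact: cvg_cst].
  have -> : 0 = 2 * (s - s) by rewrite subrr mulr0.
  apply: (ler_cvg_to h1 h2); apply: nearW => n.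
  have [_ /(_ h (above_trans _ _ _ (aboveF n) afh))] := nxP _ (bF n).
  have := PhiFs n.+1; rewrite /=; lra.
have := mulr_ge0 (ltW e0) M0; rewrite -Phif; lra.
Qed.

(** Extracts a sign from an inequality valid along a whole ray. *)
Lemma le0_of_scaled_le (a b : R) : (forall t, 0 <= t -> t * a <= b) -> a <= 0.
Proof.
move=> h; rewrite leNgt; apply/negP => a0.
have c0 : 0 <= (`|b| + 1) / a by rewrite divr_ge0 ?addr_ge0 ?(ltW a0).
have := h _ c0; rewrite divfK ?gt_eqF//; have := ler_norm b; lra.
Qed.

(* Helly's theorem for the perturbed bidual element: by the Ekeland property,
   no hyperplane separates [(0, Phi g_1, ..., Phi g_n)] from the values
   [(s, g_1 (x + u), ..., g_n (x + u))] with [|u| <= e], [|x| - f x <= s]. *)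
Lemma ekeland_helly e f d (s : seq (X -> R)) : 0 < e -> dual_ball f ->
  (forall h M, dual_ball h -> 0 <= M -> (forall x, `|h x - f x| <= M * `|x|) ->
    Phi h - Phi f <= e * M) ->
  0 < d -> {in s, forall g, is_clf g} ->
  exists x u, [/\ `|u| <= e, `|x| - f x <= d &
    {in s, forall g, `|g (x + u) - Phi g| <= d}].
Proof.
move=> e0 [cf f1] fE d0 cs.
pose n := size s; pose G (i : 'I_n) := tnth (in_tuple s) i.
have cG i : is_clf (G i) by apply: cs; exact: mem_tnth.
pose A := [set a : 'rV[R]_n.+1 | exists x u, [/\ `|u| <= e, `|x| - f x <= a ord0 ord0 &
  forall i, a ord0 (lift ord0 i) = G i (x + u)]].
pose P : 'rV[R]_n.+1 := \row_j (if unlift ord0 j is Some i then Phi (G i) else 0).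
have P0 : P ord0 ord0 = 0 by rewrite mxE unlift_none.
have PS i : P ord0 (lift ord0 i) = Phi (G i) by rewrite mxE liftK.
apply: contrapT => nxu.
have dA a : A a -> d <= `|a - P|.
  move=> [x [u [ue fx Ga]]]; rewrite leNgt; apply/negP => aP; apply: nxu.
  have coord j : `|a ord0 j - P ord0 j| <= d.
    rewrite (le_trans _ (ltW aP))// [leRHS]/Num.norm /= mx_normrE.
    apply: le_trans (le_bigmax _ (fun ij => `|(a - P) ij.1 ij.2|) (ord0, j)) => /=.
    by rewrite !mxE.
  exists x, u; split=> //.
    rewrite (le_trans fx)//; have := coord ord0; rewrite P0 subr0.
    exact: le_trans (ler_norm _).
  move=> g /(tnthP (in_tuple s)) [i ->].
  by have := coord (lift ord0 i); rewrite PS Ga.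
have A0 : A !=set0.
  exists 0, 0, 0; split=> [||i]; rewrite ?normr0 ?(ltW e0)//.
    by rewrite clf0// subrr mxE.
  by rewrite addr0 clf0// mxE.
have Acv : convex_set A.
  apply/convex_setP => a b t [x [u [ue fx Ga]]] [y [v [ve fy Gb]]] t0 t1.
  have t1' : 0 <= 1 - t by rewrite subr_ge0.
  exists (t *: x + (1 - t) *: y), (t *: u + (1 - t) *: v); split=> [||i].
  - rewrite (le_trans (ler_normD _ _))// !normrZ !ger0_norm//.
    have := ler_wpM2l t0 ue; have := ler_wpM2l t1' ve; lra.
  - rewrite !mxE (clfD _ _ cf) (clfZ t _ cf) (clfZ (1 - t) _ cf).
    have := ler_normD (t *: x) ((1 - t) *: y); rewrite !normrZ !ger0_norm//.
    have := ler_wpM2l t0 fx; have := ler_wpM2l t1' fy; lra.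
  rewrite !mxE Ga Gb addrACA -!scalerDr [RHS](clfD _ _ (cG i)).
  by rewrite (clfZ t _ (cG i)) (clfZ (1 - t) _ (cG i)).
have [L [cL _ LA]] := convex_separation A0 Acv dA.
pose mu := L (delta_mx ord0 ord0).
pose la i := L (delta_mx ord0 (lift ord0 i)).
have LE a : L a = a ord0 ord0 * mu + \sum_i la i * a ord0 (lift ord0 i).
  have Lsum (r : seq 'I_n) : L (\sum_(i <- r) a ord0 (lift ord0 i) *: delta_mx ord0 (lift ord0 i)) =
      \sum_(i <- r) la i * a ord0 (lift ord0 i).
    elim: r => [|i r IH]; first by rewrite !big_nil clf0.
    by rewrite !big_cons clfD// clfZ// IH mulrC.
  rewrite {1}[a]row_sum_delta big_ord_recl clfD// clfZ//.
  by congr (_ + _); exact: Lsum.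
pose g x := \sum_i la i * G i x.
have cg : is_clf g by exact: clf_sum.
have Phig : Phi g = \sum_i la i * Phi (G i) by exact: Phi_sum.
(* The separation inequality in coordinates. Letting the slack [t] grow gives [mu <= 0], scaling [x]
   gives [gx], and [x = 0] gives [gu]. *)
have key x u t : `|u| <= e -> 0 <= t -> (`|x| - f x + t) * mu + g (x + u) + d <= Phi g.
  move=> ue t0.
  pose a : 'rV[R]_n.+1 := \row_j (if unlift ord0 j is Some i then G i (x + u) else `|x| - f x + t).
  have a0 : a ord0 ord0 = `|x| - f x + t by rewrite mxE unlift_none.
  have aS i : a ord0 (lift ord0 i) = G i (x + u) by rewrite mxE liftK.
  have /LA : A a by exists x, u; split=> //; rewrite a0 lerDl.
  rewrite !LE a0 P0 mul0r add0r Phig /g.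
  by under eq_bigr do rewrite aS; under [X in _ <= X]eq_bigr do rewrite PS.
have mu0 : mu <= 0.
  apply: (@le0_of_scaled_le _ (Phi g - d)) => t t0.
  have := key 0 0 t; rewrite !normr0 addr0 (clf0 cf) (clf0 cg) => /(_ (ltW e0) t0); lra.
have gx x : g x <= - mu * (`|x| - f x).
  rewrite -subr_le0; apply: (@le0_of_scaled_le _ (Phi g - d)) => t t0.
  have := key (t *: x) 0 0; rewrite !normr0 !addr0 normrZ ger0_norm// (clfZ _ _ cf) (clfZ _ _ cg).
  move=> /(_ (ltW e0) (lexx 0)); lra.
have gu u : `|u| <= e -> g u <= Phi g - d.
  move=> ue; have := key 0 u 0 ue (lexx 0); rewrite normr0 (clf0 cf) subr0 addr0 mul0r !add0r; lra.
have Phigd : 0 <= Phi g - d by have := gu 0; rewrite normr0 (clf0 cg); apply; exact: ltW.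
have gM x : `|g x| <= (Phi g - d) / e * `|x|.
  have gM' y : g y <= (Phi g - d) / e * `|y|.
    have [->|y0] := eqVneq y 0; first by rewrite clf0// normr0 mulr0.
    have ny : 0 < `|y| by rewrite normr_gt0.
    have c0 : 0 < e / `|y| by rewrite divr_gt0.
    have := gu ((e / `|y|) *: y).
    rewrite normrZ (gtr0_norm c0) divfK ?gt_eqF// lexx => /(_ isT).
    rewrite (clfZ _ _ cg) mulrAC ler_pdivrMr// => h.
    by rewrite mulrAC ler_pdivlMr// mulrC.
  by rewrite ler_norml gM' andbT lerNl -clfN// -[in leRHS]normrN gM'.
have [mu00|mu_neq0] := eqVneq mu 0.
  have g0 : g = fun=> 0.
    apply/funext => x; apply/eqP; rewrite eq_le.
    have := gx x; have := gx (- x); rewrite mu00 clfN//.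
    by move=> ? ?; apply/andP; split; lra.
  by move: Phigd; rewrite g0 Phi_cst0; lra.
have m0 : 0 < - mu by rewrite oppr_gt0 lt_neqAle mu_neq0.
(* By [gx] this perturbation of [f] stays in the dual ball. Its gain [Phi g / (- mu)] exceeds the
   Ekeland bound [(Phi g - d) / (- mu)]. *)
pose h x := (- mu)^-1 * g x + f x.
have hx x : h x <= `|x|.
  by have := gx x; rewrite /h -ler_pdivrMl// => ?; lra.
have bh : dual_ball h.
  have ch : is_clf h by exact: clf_comb.
  split=> // x; rewrite ler_norml hx andbT lerNl -clfN//.
  by rewrite -[leRHS]normrN hx.
have M0 : 0 <= (- mu)^-1 * ((Phi g - d) / e).
  by rewrite mulr_ge0 ?invr_ge0 ?(ltW m0)// divr_ge0// ltW.
have hf x : `|h x - f x| <= (- mu)^-1 * ((Phi g - d) / e) * `|x|.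
  by rewrite /h addrK normrM gtr0_norm ?invr_gt0// -mulrA ler_pM2l ?invr_gt0.
have Phih : Phi h = (- mu)^-1 * Phi g + Phi f by exact: PhiL.
have := fE h _ bh M0 hf.
rewrite Phih addrK mulrCA ler_pM2l ?invr_gt0// mulrC divfK ?gt_eqF//; lra.
Qed.

End Bidual.

(** * Reflexivity from the compactness of slices *)

Section Reflexivity.
Context {R : realType} {X : completeNormedModType R}.
Hypothesis sacp : forall V : set X, V !=set0 -> closed V -> convex_set V -> SACP_cwmc V.
Variables (Phi : (X -> R) -> R) (C : R).
Hypothesis PhiL : forall (a : R) f g, is_clf f -> is_clf g ->
  Phi (fun x => a * f x + g x) = a * Phi f + Phi g.
Hypothesis PhiC : forall f (M : R), is_clf f -> (forall x, `|f x| <= M * `|x|) -> `|Phi f| <= C * M.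

(* If no point of [X] were [3e]-close to [Phi], Helly's theorem would yield an
   [e]-separated sequence in the shrinking slices of the Ekeland functional. *)
Lemma bidual_approx (e : R) : 0 < e ->
  exists c, forall g, dual_ball g -> `|Phi g - g c| <= 3 * e.
Proof.
move=> e0; apply: contrapT => /forallNP nc.
have [W WP] : {W : X -> X -> R & forall c, dual_ball (W c) /\ 3 * e < `|Phi (W c) - W c c|}.
  apply: (@choice _ _ (fun c g => dual_ball g /\ 3 * e < `|Phi g - g c|)) => c.
  have /existsNP[g /not_implyP[bg /negP]] := nc c.
  by rewrite -ltNge; exists g.
have bW c : dual_ball (W c) by have [] := WP c.
have [f bf fE] := dual_ball_ekeland PhiL PhiC e0.
have [cf f1] := bf.
(* Here [f] keeps the values [f (x n)] bounded, [W 0] keeps the new point away from 0, and the other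
   functionals keep it away from the earlier points. *)
pose fam (s : seq X) := f :: W 0 :: map W s.
have bfam s : {in fam s, forall g, dual_ball g}.
  by move=> g; rewrite !inE => /or3P[/eqP->|/eqP->|/mapP[y _ ->]].
(* The tolerance [2 e] adds the Helly precision, at most [e], to the effect of removing [u]. The
   slack shrinks with the number of earlier points, so that [|x n| - f (x n)] tends to 0. *)
have H s : exists x, `|x| - f x <= e / (size s).+1%:R /\
    {in fam s, forall g, `|g x - Phi g| <= 2 * e}.
  have d0 : 0 < e / (size s).+1%:R by rewrite divr_gt0// ltr0n.
  have de : e / (size s).+1%:R <= e.
    by rewrite ler_pdivrMr ?ltr0n// ler_peMr ?(ltW e0)// ler1n.
  have [|x [u [ue fx xu]]] := ekeland_helly PhiL PhiC (s := fam s) e0 bf fE d0.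
    by move=> g /bfam[].
  exists x; split=> // g gs; have [cg g1] := bfam _ _ gs.
  have := le_trans (xu g gs) de; rewrite (clfD _ _ cg) => h1.
  have h2 := le_trans (g1 u) ue.
  have -> : g x - Phi g = (g x + g u - Phi g) - g u by lra.
  by rewrite (le_trans (ler_normB _ _))//; lra.
have [h hP] := choice H.
pose hist := fix hist n := if n is m.+1 then h (hist m) :: hist m else [::].
pose x n := h (hist n).
have size_hist n : size (hist n) = n by elim: n => //= n ->.
have mem_hist i n : (i < n)%N -> x i \in hist n.
  elim: n => // n IH; rewrite ltnS leq_eqVlt => /predU1P[->|/IH xi]; first exact: mem_head.
  by rewrite inE xi orbT.
have fx n : `|x n| - f (x n) <= e / n.+1%:R.
  by have [+ _] := hP (hist n); rewrite size_hist.
have fle n : f (x n) <= `|x n| by exact: le_trans (ler_norm _) (f1 _).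
have xf n : `|f (x n)| <= `|Phi f| + 2 * e.
  have [_ /(_ f (mem_head _ _)) xPhi] := hP (hist n).
  rewrite -[f (x n)](subrK (Phi f)) (le_trans (ler_normD _ _))// addrC lerD2l.
  exact: xPhi.
have x_ge n : e <= `|x n|.
  have W0 : W 0 \in fam (hist n) by rewrite !inE eqxx orbT.
  have [_ /(_ _ W0) xPhi] := hP (hist n).
  have [[cW W1] ] := WP 0; rewrite (clf0 cW) subr0 => W3.
  have := W1 (x n); have := ler_normB (W 0 (x n)) (W 0 (x n) - Phi (W 0)).
  rewrite subKr -/(x n) in xPhi *; lra.
(* The functional [W (x i)] misses [Phi] by more than [3 e] at [x i] but by at most [2 e] at
   [x n]. *)
have x_sep i n : (i < n)%N -> e <= `|x n - x i|.
  move=> /mem_hist xi; have Wi : W (x i) \in fam (hist n).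
    by rewrite !inE map_f ?orbT.
  have [_ /(_ _ Wi) xPhi] := hP (hist n).
  have [[cW W1] W3] := WP (x i).
  have := W1 (x n - x i); rewrite (clfB _ _ cW).
  have := ler_normB (W (x i) (x n) - W (x i) (x i)) (W (x i) (x n) - Phi (W (x i))).
  have -> : W (x i) (x n) - W (x i) (x i) - (W (x i) (x n) - Phi (W (x i))) =
    Phi (W (x i)) - W (x i) (x i) by lra.
  rewrite -/(x n) in xPhi *; lra.
have [s sincr /cvg_ex[r sr]] : exists2 s : nat -> nat, increasing_seq s & cvgn ((f \o x) \o s).
  apply: bolzano_weierstrass; exists (`|Phi f| + 2 * e); split; first exact: num_real.
  by move=> M /ltW leM n _; exact: le_trans (xf _) leM.
have s1 n : (s n < s n.+1)%N by move/increasing_seqP : sincr; exact.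
have e_n : (fun n => e / n.+1%:R) @ \oo --> (0 : R).
  rewrite -(mulr0 e); apply: cvgM; first exact: cvg_cst.
  exact: cvg_harmonic.
have es : (fun n => e / (s n).+1%:R) @ \oo --> (0 : R).
  exact: (cvg_comp _ _ (subsequence_infty s1) e_n).
have nr : (fun n => `|x (s n)|) @ \oo --> r.
  have sr' : (fun n => f (x (s n)) + e / (s n).+1%:R) @ \oo --> r.
    by rewrite -[r]addr0; apply: cvgD.
  apply: squeeze_cvgr sr sr'; apply: nearW => n /=.
  rewrite fle /=; have := fx (s n).
  by move: (e / (s n).+1%:R) => d; lra.
have r0 : 0 < r.
  by apply: lt_le_trans e0 _; apply: (cvgr_to_ge nr); apply: nearW => n; exact: x_ge.
have [t [y [t1 ty]]] := slice_subsequence sacp (x := x \o s) cf f1 r0 sr nr.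
have e3 : 0 < e / 3 by lra.
have /cvgrPdist_le /(_ _ e3) [N _ NP] := ty.
have := x_sep _ _ (subsequence_comp s1 t1 N).
have := NP N (leqnn _); have := NP N.+1 (leqnSn _) => /= h1 h2.
have := ler_normD (x (s (t N.+1)) - y) (y - x (s (t N))).
rewrite subrKA (distrC _ y); lra.
Qed.

(** Approximants of [Phi] with error [1 / (n + 1)] form a Cauchy sequence, as the functional norming
    [c N - c n] shows. The limit represents [Phi] on the dual ball, then everywhere by scaling. *)
Lemma bidual_point : exists x0, forall f, is_clf f -> Phi f = f x0.
Proof.
have [c cP] : {c : nat -> X & forall n g, dual_ball g -> `|Phi g - g (c n)| <= n.+1%:R^-1}.
  apply: (@choice _ _ (fun n c => forall g, dual_ball g -> `|Phi g - g c| <= n.+1%:R^-1)) => n.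
  have [|c cP] := @bidual_approx (n.+1%:R^-1 / 3); first by rewrite divr_gt0 ?invr_gt0 ?ltr0n.
  by exists c => g /cP; rewrite mulrC divfK// pnatr_eq0.
have /cvg_ex[l cl] : cvg (c @ \oo).
  apply/cauchy_cvgP/cauchy_exP => e e0.
  have e2 : 0 < e / 2 by lra.
  have [N _ NP] := near_infty_natSinv_lt (PosNum e2).
  exists (c N); exists N => // n /= Nn; rewrite -ball_normE /=.
  have [g [cg g1 <-]] := norming_functional (c N - c n).
  rewrite (clfB _ _ cg); have := cP N g (conj cg g1); have := cP n g (conj cg g1).
  have hN : N.+1%:R^-1 < e / 2 := NP N (leqnn _); have hn : n.+1%:R^-1 < e / 2 := NP n Nn.
  rewrite !ler_norml => /andP[_ +] /andP[+ _].
  by move: n.+1%:R^-1 N.+1%:R^-1 hn hN => a b; lra.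
have Pb g : dual_ball g -> Phi g = g l.
  move=> bg; have [[_ gc] _] := bg.
  have gcl : (fun n => `|Phi g - g (c n)|) @ \oo --> `|Phi g - g l|.
    by apply: cvg_norm; apply: cvgB; [exact: cvg_cst|exact: (continuous_cvg _ (gc l) cl)].
  apply/eqP; rewrite -subr_eq0 -normr_le0.
  apply: (ler_cvg_to gcl (@cvg_harmonic R)); apply: nearW => n.
  exact: cP.
exists l => f cf; have [M M0 fM] := clf_bounded cf.
have M1 : 0 < M + 1 by lra.
have cg : is_clf (fun x => (M + 1)^-1 * f x).
  apply: (@bounded_clf _ _ _ ((M + 1)^-1 * M)) => [a x y|x].
    by rewrite (clfD _ _ cf) (clfZ _ _ cf) mulrDr mulrCA.
  by rewrite normrM gtr0_norm ?invr_gt0// -mulrA ler_pM2l ?invr_gt0.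
have bg : dual_ball (fun x => (M + 1)^-1 * f x).
  split=> // x; rewrite normrM gtr0_norm ?invr_gt0// ler_pdivrMl//.
  by rewrite (le_trans (fM x))// ler_wpM2r// lerDl.
have := Pb _ bg; rewrite (PhiZ PhiL PhiC)// => /(congr1 ( *%R (M + 1))).
by rewrite !mulrA divff ?gt_eqF// !mul1r.
Qed.

End Reflexivity.

Theorem theorem2p6 (R : realType) (X : completeNormedModType R) :
  (@reflexive_space R X /\ @kadec_klee R X) <->
  (forall V : set X, V !=set0 -> closed V -> convex_set V -> SACP_cwmc V).
Proof.
split=> [[refl KK] V _ Vcl Vcv|sacp]; first exact: SACP_of_reflexive_kadec_klee.
split; last exact: kadec_klee_of_SACP.
by move=> Phi PhiL [C PhiC]; exact: bidual_point PhiL PhiC.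
Qed.
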